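(* Let $\mathbb{W}=\{w\in\mathbb{R}^{n_x}\mid Vw\le \bm{1}\}$, with $V\in\mathbb{R}^{n_v\times n_x}$, be a compact convex polytope, let $\mathbb{W}_{\rm true}\subseteq\mathbb{W}$ be convex, and let $\mathcal{I}^w_k\subset\mathbb{W}_{\rm true}$ be a finite set of disturbance samples. Consider the (nonconvex) problem $$\min_{v,\alpha}\ \alpha\quad\text{s.t.}\quad w^s\in\mathcal{W}(v,\alpha)\ \ \forall w^s\in\mathcal{I}^w_k,\qquad v\in\mathbb{W},\ \alpha\in[0,1],\tag{P}$$ equivalently: minimise $\alpha$ subject to $-(1-\alpha)Vv\le\alpha\bm{1}-Vw^s$ for all $w^s\in\mathcal{I}^w_k$, $Vv\le\bm{1}$, $\alpha\in[0,1]$. Then the optimal solution of (P) can be obtained by solving the linear program $$\max_{y,\beta}\ \beta\quad\text{s.t.}\quad -Vy\le(1-\beta)\bm{1}-Vw^s\ \ \forall w^s\in\mathcal{I}^w_k,\qquad Vy\le\beta\bm{1},\quad \beta\in[0,1].\tag{LP}$$ That is, if $(y^\star,\beta^\star)$ is an optimal solution of (LP), then $(v^\star,\alpha^\star)$ is an optimal solution of (P), where $\alpha^\star=1-\beta^\star$, and $v^\star=y^\star/\beta^\star$ if $\beta^\star>0$, while $v^\star$ is an arbitrary element of $\mathbb{W}$ if $\beta^\star=0$.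
   Context: All vector inequalities are componentwise, and $\bm{1}$ is the all-ones vector. For $v\in\mathbb{W}$ and $\alpha\in[0,1]$, $$\mathcal{W}(v,\alpha):=(1-\alpha)v\oplus\alpha\mathbb{W}=\{(1-\alpha)v+\alpha w\mid w\in\mathbb{W}\}.$$ The decision variables are $v,y\in\mathbb{R}^{n_x}$ and $\alpha,\beta\in\mathbb{R}$. *)

(* Defs.v *)
From HB Require Import structures.
From mathcomp Require Import all_boot all_order all_algebra.
From mathcomp Require Import all_classical all_reals all_analysis.

Set Implicit Arguments.
Unset Strict Implicit.
Unset Printing Implicit Defensive.

Import Order.TTheory GRing.Theory Num.Theory.
Import numFieldNormedType.Exports.

Local Open Scope classical_set_scope.
Local Open Scope ring_scope.

Definition lecv (R : numDomainType) (n : nat) (x y : 'cV[R]_n) : Prop :=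
  forall i, x i 0 <= y i 0.

Notation "x <=^v y" := (lecv x y) (at level 70, y at next level) : ring_scope.

Notation ones := (const_mx 1).

Definition polytope (R : realType) (nv nx : nat) (V : 'M[R]_(nv, nx)) :
    set 'cV[R]_nx :=
  [set w | V *m w <=^v ones].

Definition shrunk (R : realType) (nx : nat) (W : set 'cV[R]_nx)
    (v : 'cV[R]_nx) (a : R) : set 'cV[R]_nx :=
  [set (1 - a) *: v + a *: w | w in W].

Definition minimizes (R : realType) (T : Type) (F : set T) (f : T -> R)
    (x : T) : Prop :=
  F x /\ forall z, F z -> f x <= f z.

Definition maximizes (R : realType) (T : Type) (F : set T) (f : T -> R)
    (x : T) : Prop :=
  F x /\ forall z, F z -> f z <= f x.

(* A point is a pair (v, a) of decision variables; the objective is a. *)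
Definition P_feasible (R : realType) (nv nx : nat) (V : 'M[R]_(nv, nx))
    (Iw : set 'cV[R]_nx) : set ('cV[R]_nx * R) :=
  [set p | [/\ forall ws, Iw ws -> shrunk (polytope V) p.1 p.2 ws,
               polytope V p.1
             & 0 <= p.2 <= 1]].

Definition P_ineq_feasible (R : realType) (nv nx : nat) (V : 'M[R]_(nv, nx))
    (Iw : set 'cV[R]_nx) : set ('cV[R]_nx * R) :=
  [set p | [/\ forall ws, Iw ws ->
                 - ((1 - p.2) *: (V *m p.1)) <=^v p.2 *: ones - V *m ws,
               V *m p.1 <=^v ones
             & 0 <= p.2 <= 1]].

(* A point is a pair (y, b) of decision variables; the objective is b. *)
Definition LP_feasible (R : realType) (nv nx : nat) (V : 'M[R]_(nv, nx))
    (Iw : set 'cV[R]_nx) : set ('cV[R]_nx * R) :=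
  [set p | [/\ forall ws, Iw ws ->
                 - (V *m p.1) <=^v (1 - p.2) *: ones - V *m ws,
               V *m p.1 <=^v p.2 *: ones
             & 0 <= p.2 <= 1]].

Definition P_optimal (R : realType) (nv nx : nat) (V : 'M[R]_(nv, nx))
    (Iw : set 'cV[R]_nx) (v : 'cV[R]_nx) (a : R) : Prop :=
  minimizes (P_feasible V Iw) snd (v, a).

Definition LP_optimal (R : realType) (nv nx : nat) (V : 'M[R]_(nv, nx))
    (Iw : set 'cV[R]_nx) (y : 'cV[R]_nx) (b : R) : Prop :=
  maximizes (LP_feasible V Iw) snd (y, b).

(* Main.v *)
(* The linear program is (P) after the substitution y = (1 - alpha) v,
   beta = 1 - alpha, which is invertible when beta > 0. When beta = 0 the
   constraints on the samples reduce to w^s in W, which holds by assumption,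
   so that v is free. The inequality form of (P) is its set form after solving
   w^s = (1 - alpha) v + alpha w for w; at alpha = 0 this division breaks down,
   and w^s = v comes from boundedness: a polytope containing 0 with a direction
   d such that V d <= 0 contains the whole ray through d, so d = 0. *)
Require Import Defs.
From HB Require Import structures.
From mathcomp Require Import all_boot all_order all_algebra.
From mathcomp Require Import all_classical all_reals all_analysis.
From mathcomp Require Import lra.

Import Order.TTheory GRing.Theory Num.Theory.
Import numFieldNormedType.Exports.

Local Open Scope classical_set_scope.
Local Open Scope ring_scope.

Lemma bounded_ray_eq0 (R : realType) (E : normedModType R) (A : set E) (d : E) :
  bounded_set A -> (forall t : R, 0 <= t -> A (t *: d)) -> d = 0.
Proof.
move=> [M [_ AM]] Ad; apply/eqP; apply: contraT => d0.
have nd : 0 < `|d| by rewrite normr_gt0.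
have ltM : M < `|M| + 1 by rewrite (le_lt_trans (ler_norm M)) // ltrDl.
(* For this parameter the point on the ray has norm [|M| + 2], beyond the valid bound [|M| + 1]. *)
have t0 : 0 <= (`|M| + 2) / `|d| by rewrite divr_ge0 // addr_ge0.
have := AM _ ltM _ (Ad _ t0).
by rewrite /= normrZ ger0_norm // divfK ?gt_eqF // lerD2l (ler_nat _ 2 1).
Qed.

Lemma polytope_recession_eq0 (R : realType) (nv nx : nat)
    (V : 'M[R]_(nv, nx)) (d : 'cV[R]_nx) :
  compact (polytope V) -> V *m d <=^v 0 -> d = 0.
Proof.
move=> /compact_bounded W_bounded Vd; apply: bounded_ray_eq0 W_bounded _ => t t0 i.
rewrite -scalemxAr !mxE; apply: le_trans ler01.
by rewrite mulr_ge0_le0 //; have := Vd i; rewrite !mxE.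
Qed.

Lemma shrunk_polytopeP (R : realType) (nv nx : nat) (V : 'M[R]_(nv, nx))
    (v ws : 'cV[R]_nx) (a : R) :
  compact (polytope V) -> polytope V v -> 0 <= a ->
  shrunk (polytope V) v a ws <->
    - ((1 - a) *: (V *m v)) <=^v a *: ones - V *m ws.
Proof.
move=> W_compact Wv a0; split=> [[w Ww <-] i | le_ws].
  rewrite mulmxDr -!scalemxAr; have := ler_wpM2l a0 (Ww i).
  (* The products are made opaque so that [mxE] does not expand them into sums. *)
  by move: (V *m w) (V *m v) => Vw Vv; rewrite !mxE; lra.
have [a_gt0 | a_le0] := ltP 0 a.
  exists (a^-1 *: (ws - (1 - a) *: v)); last first.
    by rewrite scalerA divff ?gt_eqF // scale1r addrC subrK.
  move=> i; rewrite -scalemxAr mulmxBr -scalemxAr mxE [leRHS]mxE.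
  rewrite mulrC ler_pdivrMr // mul1r; have := le_ws i.
  by move: (V *m ws) (V *m v) => Vws Vv; rewrite !mxE; lra.
have {a0 a_le0} a0 : a = 0 by apply/eqP; rewrite eq_le a_le0 a0.
(* The witness has coefficient 0, so any point of the polytope would do; what remains is
   [ws = v]. *)
exists v => //; rewrite a0 subr0 scale1r scale0r addr0.
apply/esym/eqP; rewrite -subr_eq0; apply/eqP.
(* At [a = 0], [le_ws] reads [V *m ws <=^v V *m v], so [ws - v] is a recession direction. *)
apply: polytope_recession_eq0 W_compact _ => i.
rewrite mulmxBr; have := le_ws i; rewrite a0.
by move: (V *m ws) (V *m v) => Vws Vv; rewrite !mxE; lra.
Qed.

Lemma P_feasibleE (R : realType) (nv nx : nat) (V : 'M[R]_(nv, nx))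
    (Iw : set 'cV[R]_nx) :
  compact (polytope V) -> P_feasible V Iw = P_ineq_feasible V Iw.
Proof.
move=> W_compact; apply/seteqP; split=> -[v a] [/= Iw_va Wv a01];
  have /andP[a0 _] := a01; split=> //= ws /Iw_va;
  by have [] := shrunk_polytopeP _ _ _ _ _ ws _ W_compact Wv a0.
Qed.

(** This direction of the substitution only multiplies by [1 - a >= 0], so it covers [a = 1] too,
    where the image is [(0, 0)]. *)
Lemma P_ineq_LP_feasible (R : realType) (nv nx : nat) (V : 'M[R]_(nv, nx))
    (Iw : set 'cV[R]_nx) (v : 'cV[R]_nx) (a : R) :
  P_ineq_feasible V Iw (v, a) -> LP_feasible V Iw ((1 - a) *: v, 1 - a).
Proof.
move=> [/= Iw_va Wv /andP[a0 a1]]; split=> /=.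
- by move=> ws /Iw_va; rewrite -scalemxAr subKr.
- by move=> i; rewrite -scalemxAr !mxE ler_wpM2l ?subr_ge0 //;
    have := Wv i; rewrite !mxE.
- by rewrite subr_ge0 a1 gerBl a0.
Qed.

Lemma LP_P_ineq_feasible (R : realType) (nv nx : nat) (V : 'M[R]_(nv, nx))
    (Iw : set 'cV[R]_nx) (y : 'cV[R]_nx) (b : R) :
  0 < b -> LP_feasible V Iw (y, b) ->
  P_ineq_feasible V Iw (b^-1 *: y, 1 - b).
Proof.
move=> b_gt0 [/= Iw_yb Vy /andP[b0 b1]]; split=> /=.
- move=> ws /Iw_yb; rewrite subKr -scalemxAr scalerA.
  by rewrite divff ?gt_eqF // scale1r.
- move=> i; rewrite -scalemxAr mxE [leRHS]mxE mulrC ler_pdivrMr // mul1r.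
  by have := Vy i; rewrite !mxE mulr1.
- by rewrite subr_ge0 b1 gerBl b0.
Qed.

Lemma P_ineq_feasible1 (R : realType) (nv nx : nat) (V : 'M[R]_(nv, nx))
    (Iw : set 'cV[R]_nx) (v : 'cV[R]_nx) :
  Iw `<=` polytope V -> polytope V v -> P_ineq_feasible V Iw (v, 1).
Proof.
move=> IwW Wv; split=> //=; last by rewrite ler01 lexx.
move=> ws /IwW Wws i; rewrite subrr !scale0r oppr0 scale1r.
by have := Wws i; rewrite !mxE subr_ge0.
Qed.

Theorem proposition2 (R : realType) (nx nv : nat) (V : 'M[R]_(nv, nx))
    (Wtrue Iw : set 'cV[R]_nx)
    (W_compact : compact (polytope V))
    (Wtrue_sub : Wtrue `<=` polytope V)
    (Wtrue_convex : convex_set Wtrue)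
    (Iw_sub : Iw `<=` Wtrue)
    (Iw_finite : finite_set Iw) :
  P_feasible V Iw = P_ineq_feasible V Iw /\
  forall (y : 'cV[R]_nx) (b : R), LP_optimal V Iw y b ->
    (0 < b -> P_optimal V Iw (b^-1 *: y) (1 - b)) /\
    (b = 0 -> forall v : 'cV[R]_nx, polytope V v -> P_optimal V Iw v (1 - b)).
Proof.
have PE := P_feasibleE R nv nx V Iw W_compact; split=> // y b [yb b_max].
(* Feasibility at value [1 - b] suffices: any feasible [(v', a')] gives an LP point of value
   [1 - a'], hence [1 - a' <= b]. *)
have opt v : P_ineq_feasible V Iw (v, 1 - b) -> P_optimal V Iw v (1 - b).
  rewrite /P_optimal PE => vb; split=> // -[v' a'] /P_ineq_LP_feasible /b_max /=.
  by rewrite lerBlDr addrC -lerBlDr.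
split=> [b_gt0 | b0 v Wv]; apply: opt; first exact: LP_P_ineq_feasible.
rewrite b0 subr0; apply: P_ineq_feasible1 => //.
exact: subset_trans Iw_sub Wtrue_sub.
Qed.
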